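(* Given the number $m$ of segments and the number $n$ of vertices, for any $k$ the balanced starlike tree minimizes the Steiner $k$-Wiener index; that is, if $T^*$ is the balanced starlike tree with $n$ vertices and $m$ segments, then $SW_k(T^* )\le SW_k(T)$ for every tree $T$ with $n$ vertices and $m$ segments.
   Context: All graphs are finite and simple. For a connected graph $G$ and $S\subseteq V(G)$, the Steiner distance $d(S)$ is the minimum size (number of edges) of a connected subgraph of $G$ whose vertex set contains $S$. The Steiner $k$-Wiener index is $SW_k(G)=\sum_{S\subseteq V(G),\,|S|=k} d(S)$, where $k$ is a positive integer. A branch vertex of a tree is a vertex of degree at least 3. A segment of a tree $T$ is a subpath $P$ of $T$ such that all internal vertices of $P$ have degree 2 in $T$ and each end of $P$ is either a leaf or a branch vertex of $T$. The length of a segment is its number of edges. A starlike tree is a tree obtained from a collection of paths (its segments) by identifying one end of each path in a single common vertex. A balanced starlike tree is a starlike tree whose segment lengths pairwise differ by no more than 1. The numbers $n,m$ are such that trees with $n$ vertices and $m$ segments exist. *)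

(* Defs.v *)
From mathcomp Require Import all_boot.
Set Implicit Arguments.
Unset Strict Implicit.
Unset Printing Implicit Defensive.

Record sgraph := SGraph {
  vertex :> finType;
  adj : rel vertex;
  adj_sym : symmetric adj;
  adj_irrefl : irreflexive adj
}.
Arguments adj {s} x y.

Section Graph.
Variable G : sgraph.

Definition edges : {set {set G}} := [set [set u.1; u.2] | u : G * G & adj u.1 u.2].

Definition degree (x : G) : nat := #|[set y | adj x y]|.

Definition connected : Prop := 0 < #|G| /\ forall x y : G, connect adj x y.

(* A [ucycle] of size 2 is an edge traversed back and forth, not a cycle. *)
Definition acyclic : Prop := forall c : seq G, ucycle adj c -> size c < 3.

Definition is_tree : Prop := connected /\ acyclic.

(* (vertex set, edge set) *)
Definition subgraph : Type := ({set G} * {set {set G}})%type.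

Definition is_subgraph (H : subgraph) : bool :=
  (H.2 \subset edges) && (cover H.2 \subset H.1).

Definition connected_subgraph (H : subgraph) : bool :=
  [&& is_subgraph H, H.1 != set0 &
      [forall x in H.1, forall y in H.1,
         connect [rel a b | [set a; b] \in H.2] x y]].

(* Meaningful when [G] is connected: the default value [G] itself is then an
   admissible subgraph. *)
Definition steiner_dist (S : {set G}) : nat :=
  #|([arg min_(H < ([set: G], edges) : subgraph
        | connected_subgraph H && (S \subset H.1)) #|H.2|]).2|.

Definition steiner_wiener (k : nat) : nat :=
  \sum_(S : {set G} | #|S| == k) steiner_dist S.

Definition is_leaf (x : G) : bool := degree x == 1.

Definition is_branch (x : G) : bool := 3 <= degree x.

Definition path_edges (s : seq G) : {set {set G}} :=
  [set [set u.1; u.2] | u in zip s (behead s)].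

Definition path_subgraph (s : seq G) : subgraph :=
  ([set x in s], path_edges s).

(* The internal vertices of [x :: p] are [behead (belast x p)]; the one-vertex
   path is excluded. *)
Definition segment_seq (s : seq G) : bool :=
  if s is x :: p then
    [&& p != [::], path adj x p, uniq (x :: p),
        all (fun y => degree y == 2) (behead (belast x p)),
        is_leaf x || is_branch x &
        is_leaf (last x p) || is_branch (last x p)]
  else false.

(* Segments are counted as subgraphs, so that the two orientations of a path
   give a single segment. *)
Definition segments : {set subgraph} :=
  [set H | [exists l : 'I_#|G|.+1, exists s : l.-tuple G,
              segment_seq s && (H == path_subgraph s)]].

Definition segment_length (H : subgraph) : nat := #|H.2|.

(* [c] is the common end, and the glued paths are the [c :: p], [p \in ps]. *)
Definition starlike : Prop :=
  exists (c : G) (ps : seq (seq G)),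
    [/\ [::] \notin ps,
        perm_eq (c :: flatten ps) (enum G) &
        edges = \bigcup_(p <- ps) path_edges (c :: p)].

Definition balanced_starlike_tree : Prop :=
  [/\ is_tree, starlike &
      forall P Q : subgraph, P \in segments -> Q \in segments ->
        segment_length P <= (segment_length Q).+1].

End Graph.

(* Main.v *)
Require Import Defs.
From mathcomp Require Import all_boot zify.

(** In a tree a set [S] is joined by the edges that separate two of its
vertices, so [d(S)] is the number of edges separating [S].  Summing over the
[k]-subsets, an edge whose removal leaves sides of [a] and [n - a] vertices
contributes [C(n,k) - C(a,k) - C(n-a,k)].  For [a <= n/2] this is the sum over
[t < a] of the increments [cut_gain n k t = C(n-t-1,k-1) - C(t,k-1)], which are
nonnegative.  Hence ([steiner_wienerE]) the index is the sum over [t] of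
[cut_gain n k t] times the number of edges whose smaller side has more than [t]
vertices, and it is enough to compare these numbers for each [t].

In an arbitrary tree, the smaller side of every edge contains a leaf, and that
leaf together with the size of the side determines the edge: two sides with a
common leaf are nested or cover the tree, and two sides of equal size at most
[n / 2] can do neither unless they are equal ([side_small_inj]).  So at most
[t] times the number of leaves of the [n - 1] edges have a smaller side of at
most [t] vertices ([card_heavy_edges_geq]).
A leaf lies on exactly one segment, and a segment with two leaves is the whole
tree; a tree with [m] segments therefore has at most [max 2 m] leaves
([card_leaves_leq]).

A starlike tree with [L] legs has at most [L] segments.  An edge at distance
[i] from the centre on a leg of length [l] has a side of [l - i] vertices, so
at most [sum_l (l - t)] edges have a smaller side of more than [t] vertices.
If [L >= 3] the legs are segments, hence balanced, and that sum is
[n - 1 - t * L] truncated at 0; if [L <= 2] the tree is a path, and using both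
sides of each edge gives the bound [n - 1 - 2 * t]
([card_heavy_edges_starlike]).  This is the lower bound found for an arbitrary
tree with the same number of segments. *)

Set Implicit Arguments.
Unset Strict Implicit.
Unset Printing Implicit Defensive.

(** * Counting in finite sets and sequences *)

Lemma set2_eq (T : finType) (a b u v : T) :
  [set a; b] = [set u; v] -> (a = u /\ b = v) \/ (a = v /\ b = u).
Proof.
move=> /setP E.
have := E a; have := E b; have := E u; have := E v.
rewrite !inE !eqxx ?orbT /=.
case/orP=> /eqP ?; case/orP=> /eqP ?; case/esym/orP=> /eqP ?; case/esym/orP=> /eqP ?;
  by subst; auto.
Qed.

(** Double counting of the related pairs: it serves wherever each element of [X]
is to be charged to one of [Y], without choosing a charging function. *)
Lemma leq_card_rel (A B : finType) (X : {set A}) (Y : {set B})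
    (R : A -> B -> bool) (m : nat) :
  (forall x, x \in X -> exists2 y, y \in Y & R x y) ->
  (forall y, y \in Y -> #|[set x in X | R x y]| <= m) ->
  #|X| <= #|Y| * m.
Proof.
move=> XY YX.
have le1 : #|X| <= \sum_(x in X) \sum_(y in Y) R x y.
  rewrite -sum1_card; apply: leq_sum => x /XY[y Yy Rxy].
  by rewrite (bigD1 y) //= Rxy.
apply: leq_trans le1 _; rewrite exchange_big /= -sum_nat_const.
apply: leq_sum => y /YX; apply: leq_trans; rewrite -sum1_card -big_mkcondr /=.
by rewrite leq_eqVlt; apply/orP; left; apply/eqP/eq_bigl => x; rewrite inE.
Qed.

Lemma card_inj_itv (T : finType) (A : {set T}) (f : T -> nat) (a b : nat) :
  {in A &, injective f} -> {in A, forall x, a <= f x < b} -> #|A| <= b - a.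
Proof.
move=> inj_f f_itv; rewrite cardE -(size_map f) -(size_iota a (b - a)).
apply: uniq_leq_size.
  by rewrite map_inj_in_uniq ?enum_uniq // => x y; rewrite !mem_enum; apply: inj_f.
move=> _ /mapP[x + ->]; rewrite mem_enum => /f_itv; rewrite mem_iota; lia.
Qed.

Lemma uniq_flatten_nnil (T : eqType) (ss : seq (seq T)) :
  [::] \notin ss -> uniq (flatten ss) -> uniq ss.
Proof.
elim: ss => //= s ss IHss; rewrite inE negb_or eq_sym cat_uniq.
case/andP=> s_n0 ss_n0 /and3P[_ disj u]; rewrite IHss // andbT.
apply: contra disj => s_ss; case: s s_n0 s_ss => // x s _ s_ss.
apply/hasP; exists x; rewrite ?mem_head //.
by apply/flattenP; exists (x :: s); rewrite ?mem_head.
Qed.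

Lemma flatten_disjoint (T : eqType) (ss : seq (seq T)) (p q : seq T) (x : T) :
  uniq (flatten ss) -> p \in ss -> q \in ss -> x \in p -> x \in q -> p = q.
Proof.
elim: ss => //= s ss IHss; rewrite cat_uniq !inE => /and3P[_ disj u].
have no r : x \in s -> r \in ss -> x \in r -> False.
  move=> xs r_ss xr; case/hasP: disj; exists x => //.
  by apply/flattenP; exists r.
case/predU1P=> [->|p_ss]; case/predU1P=> [->|q_ss] // xp xq; last exact: IHss.
- by case: (no q).
- by case: (no p).
Qed.

Lemma uniq_flatten_mem (T : eqType) (ss : seq (seq T)) (p : seq T) :
  uniq (flatten ss) -> p \in ss -> uniq p.
Proof.
elim: ss => //= s ss IHss; rewrite cat_uniq inE => /and3P[us _ u].
by case/predU1P=> [->|/IHss->].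
Qed.

Lemma mem_bigcup_seq (I : eqType) (T : finType) (r : seq I)
    (F : I -> {set T}) (x : T) :
  reflect (exists2 i, i \in r & x \in F i) (x \in \bigcup_(i <- r) F i).
Proof.
have -> : (x \in \bigcup_(i <- r) F i) = has (fun i => x \in F i) r.
  by elim: r => [|i r IHr]; rewrite ?big_nil ?big_cons inE //= IHr.
exact: hasP.
Qed.

Lemma leq_card_bigcup_seq (I : eqType) (T : finType) (r : seq I)
    (F : I -> {set T}) (P : pred T) (m : I -> nat) :
  (forall i, i \in r -> #|[set x in F i | P x]| <= m i) ->
  #|[set x in \bigcup_(i <- r) F i | P x]| <= \sum_(i <- r) m i.
Proof.
elim: r => [|i r IHr] Fm.
  by rewrite !big_nil leqn0 cards_eq0; apply/eqP/setP=> x; rewrite !inE.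
rewrite !big_cons setIdE setIUl -!setIdE.
apply: leq_trans (leq_card_setU _ _) (leq_add _ _).
  by apply: Fm; rewrite mem_head.
by apply: IHr => j j_r; apply: Fm; rewrite in_cons j_r orbT.
Qed.

(** * Increments of the separation count *)

(** The growth of [C(n,k) - C(a,k) - C(n-a,k)] when [a] passes from [t] to [t + 1],
for [2 * t < n]. *)
Definition cut_gain (n k t : nat) : nat := 'C(n - t.+1, k.-1) - 'C(t, k.-1).

(** Pascal's rule telescopes the sum.  Up to [n / 2] the increments are
nonnegative, so the truncated subtraction in [cut_gain] is exact; at [a = 0]
both sides vanish because [k] is positive. *)
Lemma sum_cut_gain n k a : 0 < k -> a.*2 <= n ->
  \sum_(t < a) cut_gain n k t = 'C(n, k) - 'C(a, k) - 'C(n - a, k).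
Proof.
move=> k_gt0 a_le.
suff : \sum_(t < a) cut_gain n k t + 'C(a, k) + 'C(n - a, k) = 'C(n, k) by lia.
elim: a a_le => [|a IHa] a_le; first by rewrite big_ord0 subn0 bin0n gtn_eqF.
have {}IHa := IHa ltac:(lia).
have mono : 'C(a, k.-1) <= 'C(n - a.+1, k.-1) by apply: leq_bin2l; lia.
rewrite big_ord_recr -IHa /cut_gain /=.
have -> : n - a = (n - a.+1).+1 by lia.
case: k k_gt0 mono {IHa} => [//|k] _ /= mono; rewrite !binS; lia.
Qed.

(** * Steiner distance and separating edges *)

Section Separation.
Variable G : sgraph.
Implicit Types (x y z u v a b : G) (p q s : seq G) (S : {set G}) (e : {set G}).

Lemma adjC x y : adj x y = adj y x.
Proof. exact: adj_sym. Qed.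

Lemma adj_neq x y : adj x y -> x != y.
Proof. by apply: contraTneq => ->; rewrite adj_irrefl. Qed.

Lemma mem_edges x y : ([set x; y] \in edges G) = adj x y.
Proof.
apply/imsetP/idP => [[[u v]]|xy]; last by exists (x, y); rewrite ?inE.
by rewrite inE /= => uv /set2_eq[][-> ->] //; rewrite adjC.
Qed.

Lemma edgesP e : reflect (exists u v, adj u v /\ e = [set u; v]) (e \in edges G).
Proof.
apply: (iffP imsetP) => [[[u v]]|[u [v [uv ->]]]].
  by rewrite inE => uv ->; exists u, v.
by exists (u, v); rewrite ?inE.
Qed.

Definition cut_adj e : rel G := [rel a b | adj a b && ([set a; b] != e)].

Definition side e x : {set G} := [set y | connect (cut_adj e) x y].

Lemma cut_connect_sym e : connect_sym (cut_adj e).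
Proof. by apply: sym_connect_sym => a b; rewrite /cut_adj /= adjC setUC. Qed.

Lemma side_id e x : x \in side e x.
Proof. by rewrite inE connect0. Qed.

Lemma side_eqP e x y : reflect (side e x = side e y) (x \in side e y).
Proof.
apply: (iffP idP) => [|<-]; last exact: side_id.
rewrite inE => yx; apply/setP=> z; rewrite !inE.
by rewrite (same_connect (@cut_connect_sym e) yx).
Qed.

Lemma side_step e a b : adj a b -> [set a; b] != e -> side e a = side e b.
Proof.
move=> ab ne; apply/side_eqP.
by rewrite inE cut_connect_sym connect1 // /cut_adj /= ab.
Qed.

(** A path that misses an endpoint of [e] cannot use the edge [e]. *)
Lemma side_path e x p y : path adj x p -> y \in e -> y \notin x :: p ->
  last x p \in side e x.
Proof.
move=> xp ye y_p; rewrite inE; apply/connectP; exists p => //.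
apply: (sub_in_path (P := mem (x :: p)) (e := adj)) xp; last by apply/allP.
move=> a b /= ap bp ab; rewrite /cut_adj /= ab; apply: contraNneq y_p => E.
by move: ye; rewrite -E => /set2P[]->.
Qed.

(** The number of vertices on the smaller side of [e], written with a maximum
because [maxn] has the neutral element [0] and the two sides of an edge of a
tree are complementary. *)
Definition minside e : nat := #|G| - \max_(x in e) #|side e x|.

Definition separates e S : bool := [exists x in S, exists y in S, y \notin side e x].

Definition leaves : {set G} := [set x | is_leaf x].

Lemma path_connected x y : connected G ->
  exists p, [/\ path adj x p, uniq (x :: p) & last x p = y].
Proof.
case=> _ /(_ x y) /connectP[p xp ->]; case: (shortenP xp) => q xq uq _.
by exists q.
Qed.

Section Tree.
Hypothesis G_tree : is_tree G.

(** Otherwise a simple path from [u] to [v] avoiding the edge would close up to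
a cycle. *)
Lemma bridge u v : adj u v -> v \notin side [set u; v] u.
Proof.
move=> uv; apply/negP; rewrite inE => /connectP[p0 up0 vE].
move: up0 vE => /shortenP[p up u_p _] vE {p0}.
have up' : path adj u p by apply: sub_path up => a b /andP[].
have := G_tree.2 (u :: p); rewrite /ucycle /= rcons_path up' -vE adjC uv /=.
case: p up u_p vE {up'} => [|a [|b p]] /= up u_p vE.
- by move: uv; rewrite vE adj_irrefl.
- by move: up; rewrite /cut_adj /= -vE eqxx andbF.
- by move=> /(_ u_p).
Qed.

Lemma sideC u v : adj u v -> side [set u; v] v = ~: side [set u; v] u.
Proof.
move=> uv; set e := [set u; v].
(* The union of the two sides is closed under adjacency. *)
have all_in w : (w \in side e u) || (w \in side e v).
  have [p [up _ <-]] := path_connected u w G_tree.1.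
  elim/last_ind: p up => [|p w' IHp]; first by rewrite side_id.
  rewrite rcons_path last_rcons => /andP[/IHp {}IHp ab].
  have [E|ne] := eqVneq [set last u p; w'] e.
    by case/set2_eq: E => [][_ ->]; rewrite side_id ?orbT.
  by rewrite !(sameP (side_eqP _ _ _) eqP) -(side_step ab ne)
    -!(sameP (side_eqP _ _ _) eqP).
apply/setP => w; rewrite in_setC; apply/idP/idP => [wv|/negbTE wu].
  apply/negP=> wu; move/negP: (bridge uv); apply; apply/side_eqP.
  by rewrite -(side_eqP _ _ _ wv); apply/side_eqP.
by have := all_in w; rewrite wu.
Qed.

Lemma card_sides u v : adj u v ->
  #|side [set u; v] u| + #|side [set u; v] v| = #|G|.
Proof. by move=> uv; rewrite sideC // cardsC. Qed.

Lemma minsideE u v : adj u v ->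
  minside [set u; v] = minn #|side [set u; v] u| #|side [set u; v] v|.
Proof.
move=> uv; rewrite /minside big_setU1 ?inE ?adj_neq //= big_set1.
by rewrite -(card_sides uv); lia.
Qed.

Lemma minside_itv e : e \in edges G -> 0 < minside e /\ (minside e).*2 <= #|G|.
Proof.
case/edgesP=> u [v [uv ->]]; rewrite minsideE //.
have := card_sides uv.
have : 0 < #|side [set u; v] u| by apply/card_gt0P; exists u; exact: side_id.
have : 0 < #|side [set u; v] v| by apply/card_gt0P; exists v; exact: side_id.
lia.
Qed.

(** The two parts of the path lie on different sides of the edge between them,
since neither uses that edge again and the edge is a bridge. *)
Lemma path_separates x p b q : path adj x (p ++ b :: q) -> uniq (x :: p ++ b :: q) ->
  last b q \notin side [set last x p; b] x.
Proof.
rewrite -cat_cons cat_uniq cat_path => /= /and3P[xp ab bq] /and3P[u_p].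
rewrite negb_or => /andP[b_p /hasPn q_p] u_q.
have xa : last x p \in side [set last x p; b] x.
  by apply: (side_path (y := b)); rewrite ?inE ?eqxx ?orbT //; rewrite inE in b_p.
have bl : last b q \in side [set last x p; b] b.
  apply: (side_path (y := last x p)); rewrite ?inE ?eqxx ?orbT // negb_or.
  rewrite adj_neq //=; apply/negP=> /q_p /=; apply/negP; rewrite negbK; exact: mem_last.
apply: contra (bridge ab) => /side_eqP E; apply/side_eqP.
by rewrite (side_eqP _ _ _ xa) -E; apply/esym/side_eqP.
Qed.

Lemma separatesE u v S : adj u v ->
  separates [set u; v] S =
  ~~ (S \subset side [set u; v] u) && ~~ (S \subset side [set u; v] v).
Proof.
move=> uv; set e := [set u; v]; apply/idP/idP => [|/andP[/subsetPn[x xS xu]]].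
  case/existsP=> x /andP[xS /existsP[y /andP[yS]]] y_x.
  apply/andP; split; apply: contra y_x => /subsetP sub; apply/side_eqP.
  - by rewrite (side_eqP _ _ _ (sub _ xS)); apply/side_eqP/sub.
  - by rewrite (side_eqP _ _ _ (sub _ xS)); apply/side_eqP/sub.
case/subsetPn=> y yS; rewrite sideC // inE negbK => yu.
apply/existsP; exists x; rewrite xS; apply/existsP; exists y; rewrite yS /=.
by apply: contra xu => /side_eqP E; apply/side_eqP; rewrite -E; apply/side_eqP.
Qed.

Definition separating S : {set {set G}} := [set e in edges G | separates e S].

(** A connected subgraph omitting a separating edge would stay on one side of it. *)
Lemma separating_sub_connected S H :
  connected_subgraph H -> S \subset H.1 -> separating S \subset H.2.
Proof.
case/and3P=> /andP[/subsetP He _] _ /forallP cH /subsetP SH; apply/subsetP=> e.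
rewrite inE => /andP[eG /existsP[x /andP[xS /existsP[y /andP[yS]]]]].
apply: contraR => eH; rewrite inE.
have := cH x; rewrite SH //= => /forallP/(_ y); rewrite SH //=.
apply: connect_sub => a b /= abH; apply: connect1; rewrite /cut_adj /= -mem_edges He //=.
by apply: contraNneq eH => <-.
Qed.

(** All edges of the simple path between two vertices of [S] separate [S], so
they connect [S].  An endpoint of a separating edge lies on such a path, for a
path missing it would not cross the edge. *)
Lemma separating_connected S : S != set0 ->
  connected_subgraph (S :|: cover (separating S), separating S).
Proof.
move=> S_n0; set E := separating S; set r := [rel a b | [set a; b] \in E].
have r_sym : connect_sym r by apply: sym_connect_sym => a b; rewrite /= setUC.
have pathS x p : path adj x p -> uniq (x :: p) -> x \in S -> last x p \in S ->
    {in x :: p, forall z, connect r x z}.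
  move=> xp up xS yS; apply: path_connect; apply/(pathP x) => i ip.
  have aE : nth x (x :: p) i = last x (take i p).
    by rewrite (last_nth x) size_takel 1?ltnW // -(nth_take x (ltnSn i)).
  have pE : p = take i p ++ nth x p i :: drop i.+1 p.
    by rewrite -drop_nth ?cat_take_drop.
  rewrite aE; move: xp up yS; rewrite {1 2 3}pE.
  move=> xp up yS; rewrite /r /= inE mem_edges.
  move: (xp); rewrite cat_path /= => /and3P[_ -> _] /=.
  apply/existsP; exists x; rewrite xS; apply/existsP; eexists.
  apply/andP; split; first exact: yS.
  by rewrite last_cat /=; apply: path_separates.
have connS x y : x \in S -> y \in S -> connect r x y.
  move=> xS yS; have [p [xp up yE]] := path_connected x y G_tree.1.
  by rewrite -yE in yS *; apply: (pathS x p xp up xS yS); rewrite mem_last.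
have to_S z : z \in S :|: cover E -> exists2 x, x \in S & connect r x z.
  case/setUP=> [zS|/bigcupP[e]]; first by exists z.
  rewrite inE => /andP[eG /existsP[x /andP[xS /existsP[y /andP[yS]]]]] y_x ze.
  exists x => //; have [p [xp up yE]] := path_connected x y G_tree.1.
  rewrite -yE in yS y_x; apply: (pathS x p xp up xS yS).
  by apply: contraR y_x; apply: side_path.
apply/and3P; split.
- apply/andP; split; last by apply: subsetUr.
  by apply/subsetP=> e; rewrite inE => /andP[].
- case/set0Pn: S_n0 => x xS; apply/set0Pn; exists x; by rewrite inE xS.
- apply/forallP=> z; apply/implyP=> /to_S[x xS xz].
  apply/forallP=> w; apply/implyP=> /to_S[y yS yw].
  apply: connect_trans yw; apply: connect_trans (connS x y xS yS).
  by rewrite r_sym.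
Qed.

Lemma full_connected_subgraph : connected_subgraph ([set: G], edges G).
Proof.
apply/and3P; split; first by rewrite /is_subgraph subxx subsetT.
  case: G_tree.1 => /card_gt0P[x _] _; by apply/set0Pn; exists x.
apply/forallP=> x; apply/implyP=> _; apply/forallP=> y; apply/implyP=> _.
rewrite (eq_connect (e' := adj)); last by move=> a b; rewrite /= mem_edges.
exact: G_tree.1.2.
Qed.

Lemma steiner_distE S : S != set0 -> steiner_dist S = #|separating S|.
Proof.
move=> S_n0; rewrite /steiner_dist; case: arg_minnP => /=.
  by rewrite full_connected_subgraph subsetT.
move=> H /andP[cH SH] minH; apply/eqP; rewrite eqn_leq; apply/andP; split.
  apply: (minH (S :|: cover (separating S), separating S)).
  by rewrite separating_connected // subsetUl.
exact/subset_leq_card/separating_sub_connected.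
Qed.

(** The [k]-subsets that [e] does not separate are those lying within one of its
two sides. *)
Lemma card_separated k e : 0 < k -> e \in edges G ->
  #|[set S : {set G} | #|S| == k & separates e S]|
  = \sum_(t < minside e) cut_gain #|G| k t.
Proof.
move=> k_gt0 eG; rewrite sum_cut_gain //; last by case: (minside_itv eG).
case/edgesP: eG => u [v [uv ->]]; set e' := [set u; v].
pose inside (A : {set G}) := [set S : {set G} | S \subset A & #|S| == k].
(* A set within both sides would be empty, whereas [k] is positive. *)
have disj : [disjoint inside (side e' u) & inside (side e' v)].
  apply/pred0P=> S /=; rewrite !inE; apply/negP.
  case/andP=> /andP[Su /eqP Sk] /andP[Sv _].
  have : S \subset set0 by rewrite -(setICr (side e' u)) subsetI Su -sideC.
  by rewrite subset0 => /eqP S0; rewrite -Sk S0 cards0 in k_gt0.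
have -> : [set S : {set G} | #|S| == k & separates e' S]
  = [set S : {set G} | #|S| == k] :\: (inside (side e' u) :|: inside (side e' v)).
  apply/setP=> S; rewrite !inE (separatesE _ uv).
  by case: (#|S| == k); rewrite ?andbF ?andbT // negb_or.
rewrite cardsD card_draws (setIidPr _); last first.
  by apply/subsetP=> S; rewrite !inE => /orP[]/andP[].
rewrite cardsU disjoint_setI0 // cards0 subn0 !cards_draws minsideE //.
have := card_sides uv; rewrite -/e'; set a := #|side _ u|; set b := #|side _ v|.
by move=> <-; rewrite subnDA; case: (leqP a b) => ab; rewrite ?addKn ?addnK // subnAC.
Qed.

Lemma steiner_wienerE k : 0 < k ->
  steiner_wiener G k =
  \sum_(t < #|G|) #|[set e in edges G | t < minside e]| * cut_gain #|G| k t.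
Proof.
move=> k_gt0; rewrite /steiner_wiener.
transitivity (\sum_(S : {set G} | #|S| == k) \sum_(e in edges G) separates e S).
  apply: eq_bigr => S /eqP Sk; rewrite steiner_distE; last first.
    by rewrite -card_gt0 Sk.
  rewrite -sum1_card -big_mkcondr; apply: eq_bigl => e; by rewrite inE.
rewrite exchange_big /=.
transitivity (\sum_(e in edges G) \sum_(t < #|G|) (t < minside e) * cut_gain #|G| k t).
  apply: eq_bigr => e eG; rewrite -big_mkcondr /= sum1dep_card card_separated //.
  rewrite (big_ord_widen #|G|); last by case: (minside_itv eG); lia.
  rewrite big_mkcond; apply: eq_bigr => t _; by case: ifP; rewrite ?mul1n.
rewrite exchange_big /=; apply: eq_bigr => t _; rewrite -big_distrl /=; congr (_ * _).
by rewrite -[RHS]sum1_card -big_mkcondr; apply: eq_bigl => e; rewrite inE.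
Qed.

End Tree.
End Separation.

(** * Leaves and small sides of edges *)

Section SmallSides.
Variable G : sgraph.
Implicit Types (x y z u v a b : G) (p q s : seq G) (S : {set G}) (e : {set G}).

Section Tree.
Hypothesis G_tree : is_tree G.

(** Any other neighbour on the path would close a cycle. *)
Lemma path_turns_back x p y z : path adj x (rcons p y) -> uniq (x :: rcons p y) ->
  adj y z -> z \in x :: rcons p y -> z = last x p.
Proof.
move=> xp up yz; rewrite -rcons_cons mem_rcons inE eq_sym (negbTE (adj_neq yz)) /= => zp.
move: zp xp up => /splitPl[p1 p2 zE]; rewrite rcons_cat cat_path zE => /andP[_ zp].
rewrite -cat_cons cat_uniq => /and3P[up1 disj up2].
have up : uniq (z :: rcons p2 y).
  rewrite /= up2 andbT; apply: contra disj => z2; apply/hasP; exists z => //.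
  by rewrite -zE mem_last.
have := G_tree.2 (z :: rcons p2 y); rewrite /ucycle up andbT /= rcons_path last_rcons zp yz.
by move=> /(_ isT); rewrite size_rcons; case: p2 {zp up up2 disj} => //; rewrite cats0.
Qed.

(** As long as the last vertex is not a leaf it has a neighbour besides its
predecessor, and acyclicity puts that neighbour off the path. *)
Lemma path_to_leaf x p y : path adj x (rcons p y) -> uniq (x :: rcons p y) ->
  exists q, [/\ path adj x (rcons p y ++ q), uniq (x :: rcons p y ++ q)
              & is_leaf (last y q)].
Proof.
have [m] := ubnP (#|G| - size p); elim: m p y => // m IHm p y szm xp up.
have [leaf_y|nleaf] := boolP (is_leaf y); first by exists [::]; rewrite cats0.
have ay : adj y (last x p) by move: xp; rewrite rcons_path adjC => /andP[].
have /card_gt0P[z] : 0 < #|[set z | adj y z] :\ last x p|.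
  move: nleaf; rewrite /is_leaf /degree (cardsD1 (last x p)) inE ay /=; lia.
rewrite !inE => /andP[z_ne yz].
have z_p : z \notin x :: rcons p y
  by apply: contraNN z_ne => zp; apply/eqP/(path_turns_back xp).
have uz : uniq (x :: rcons (rcons p y) z) by rewrite -rcons_cons rcons_uniq z_p.
have [|||q []] := IHm (rcons p y) z.
- have : size (x :: rcons p y) <= #|G| by rewrite -(card_uniqP up) max_card.
  by rewrite /= in szm *; rewrite size_rcons; lia.
- by rewrite rcons_path xp last_rcons.
- exact: uz.
by rewrite cat_rcons => ? ? ?; exists (z :: q).
Qed.

Lemma leaf_in_side u v : adj u v ->
  exists2 x, x \in leaves G & x \in side [set u; v] v.
Proof.
move=> uv; have [|/=|q [uq nq lf]] := @path_to_leaf u [::] v; rewrite /= ?uv ?andbT //.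
  by rewrite inE adj_neq.
exists (last v q); first by rewrite inE.
move: uq nq => /= /andP[_ vq] /andP[u_q _].
by apply: side_path vq _ u_q; rewrite !inE eqxx.
Qed.

Lemma leaf_in_minside e : e \in edges G ->
  exists2 x, x \in leaves G & #|side e x| == minside e.
Proof.
case/edgesP=> u [v [uv ->]]; rewrite minsideE //.
case: (leqP #|side [set u; v] u| #|side [set u; v] v|) => _; last first.
  by have [x xL /side_eqP <-] := leaf_in_side uv; exists x.
move: uv; rewrite setUC adjC => vu.
by have [x xL /side_eqP <-] := leaf_in_side vu; exists x.
Qed.

(** Lets an argument about the side of [x] assume that [x] is an endpoint of [e]. *)
Lemma side_of_end e x : e \in edges G ->
  exists u v, [/\ adj u v, e = [set u; v] & side e x = side e u].
Proof.
case/edgesP=> u [v [uv ->]]; have [xu|xv] := boolP (x \in side [set u; v] u).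
  by exists u, v; split=> //; apply/side_eqP.
exists v, u; split; [by rewrite adjC | by rewrite setUC | apply/side_eqP].
by rewrite sideC // inE.
Qed.

(** A walk inside a side that does not contain [e'] never uses [e']. *)
Lemma side_sub_side e e' x : e' \in edges G -> e != e' ->
  ~~ (e' \subset side e x) -> side e x \subset side e' x.
Proof.
move=> e'G ne out.
have off z : z \in side e x -> z \notin e'.
  case/edgesP: e'G out ne => a [b [ab ->]] out ne /side_eqP zx.
  apply: contra out => /set2P zab; apply/subsetP=> d /set2P dab.
  apply/side_eqP; rewrite -zx.
  have abE : side e a = side e b by apply: side_step; rewrite // eq_sym.
  by case: zab => ->; case: dab => ->; rewrite ?abE.
apply/subsetP=> w; rewrite inE => /connectP[p xp ->].
elim/last_ind: p xp => [|p c IHp]; first by rewrite side_id.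
rewrite rcons_path last_rcons => /andP[xp /andP[/= ac _]].
apply/side_eqP; have /side_eqP <- := IHp xp; apply/esym/side_step => //.
have : last x p \notin e' by apply: off; rewrite inE; apply/connectP; exists p.
by apply: contraNneq => <-; rewrite !inE eqxx.
Qed.

(** Let [A] and [A'] be the two sides of [x], for distinct [e] and [e'].  They
differ, since [e] leaves [A] but not [A'].  If [A] does not contain [e'], or
[A'] does not contain [e], one side is inside the other, and equality of sizes
makes them equal.  Otherwise the complement of [A] is inside [A'] and at
least as large, hence equal to [A']; but [x] is not in it. *)
Lemma side_small_inj e e' x : e \in edges G -> e' \in edges G ->
  #|side e x| = #|side e' x| -> #|side e x|.*2 <= #|G| -> e = e'.
Proof.
move=> eG e'G cardE small; apply/eqP/negPn/negP => ne.
have [u [v [uv eE xu]]] := side_of_end x eG.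
have BE : side e v = ~: side e x by rewrite xu {1 2}eE sideC.
have side'E : side e' u = side e' v by apply: side_step; rewrite // -eE.
(* The edge [e] leaves the first set, but not the second. *)
have sides_ne : side e x != side e' x.
  apply/eqP=> E; move: (bridge G_tree uv); rewrite -eE -xu E.
  move/negP; apply; apply/side_eqP; rewrite -side'E; apply/side_eqP.
  by rewrite -E xu side_id.
have [e'A|out] := boolP (e' \subset side e x); last first.
  by case/negP: sides_ne; rewrite eqEcard side_sub_side //= cardE.
have [eA'|out] := boolP (e \subset side e' x); last first.
  case/negP: sides_ne; rewrite eq_sym eqEcard cardE leqnn andbT.
  by apply: side_sub_side; rewrite // eq_sym.
have vA' : side e' v = side e' x.
  by apply/side_eqP/(subsetP eA'); rewrite eE !inE eqxx orbT.
have BA' : side e v \subset side e' x.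
  rewrite -vA'; apply: side_sub_side => //.
  case/edgesP: e'G e'A => a [b [_ ->]] /subsetP/(_ a (set21 a b)) aA.
  by apply/negP=> /subsetP/(_ a (set21 a b)); rewrite BE inE aA.
have : side e v == side e' x.
  by rewrite eqEcard BA' BE -cardE; have := cardsC (side e x); lia.
move/eqP=> E; have := side_id e' x.
by rewrite -E BE inE side_id.
Qed.

(** Each vertex other than a root [r] is charged to the first edge of its path to
[r]; that edge has only one endpoint on the side away from [r]. *)
Lemma card_edges_tree : #|G|.-1 <= #|edges G|.
Proof.
have [r _] := card_gt0P G_tree.1.1.
have := @leq_card_rel _ _ [set~ r] (edges G)
  (fun x e => (x \in e) && (r \notin side e x)) 1.
rewrite cardsC1 muln1; apply=> [x|e].
  rewrite !inE => xr; have [[|b p] [xp up pE]] := path_connected x r G_tree.1.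
    by rewrite -pE eqxx in xr.
  exists [set x; b]; first by rewrite mem_edges; case/andP: xp.
  by rewrite -pE !inE eqxx; have := @path_separates _ G_tree x [::] b p xp up; rewrite inE.
move=> eG; have [u [v [uv eE ru]]] := side_of_end r eG.
rewrite -(cards1 v); apply/subset_leq_card/subsetP=> x; rewrite in_set1 => /setIdP[_].
rewrite {1}eE => /andP[/set2P[] -> //].
by move=> /negP[]; apply/side_eqP.
Qed.

(** The edges whose smaller side has size at most [t] are charged to a leaf in
that side; those charged to one leaf have distinct sizes in [1..t]. *)
Lemma card_heavy_edges_geq t :
  #|G|.-1 - t * #|leaves G| <= #|[set e in edges G | t < minside e]|.
Proof.
have : #|[set e in edges G | minside e <= t]| <= #|leaves G| * t.
  apply: (leq_card_rel (R := fun e x => #|side e x| == minside e)) => [e|x xL].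
    by rewrite inE => /andP[/leaf_in_minside ? _].
  apply: leq_trans (card_inj_itv (f := @minside G) (a := 1) (b := t.+1) _ _) _; last by lia.
    move=> e e'; rewrite !inE => /andP[/andP[eG _] /eqP se] /andP[/andP[e'G _] /eqP se'] E.
    apply: (side_small_inj (x := x)) => //; first by rewrite se se'.
    by rewrite se; case: (minside_itv G_tree eG).
  move=> e; rewrite !inE => /andP[/andP[/(minside_itv G_tree)[e0 _] et] _]; lia.
have := card_edges_tree.
rewrite -(cardsID [set e | minside e <= t] (edges G)) => le1 lightE.
have -> : [set e in edges G | t < minside e] = edges G :\: [set e | minside e <= t].
  by apply/setP=> e; rewrite !inE -ltnNge andbC.
rewrite leq_subLR; apply: leq_trans le1 _.
by rewrite -setIdE leq_add2r mulnC lightE.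
Qed.
End Tree.
End SmallSides.

(** * Segments and leaves *)

Section Segments.
Variable G : sgraph.
Implicit Types (x y z u v a b : G) (p q s : seq G) (S : {set G}) (e : {set G}).

Lemma path_edgesP x0 s e :
  reflect (exists2 i, i.+1 < size s & e = [set nth x0 s i; nth x0 s i.+1])
          (e \in path_edges s).
Proof.
apply: (iffP imsetP) => [[[u v] /= uvs ->]|[i i_s ->]].
  have [i] := nthP (x0, x0) uvs; rewrite size_zip size_behead => i_lt.
  rewrite nth_zip_cond size_zip size_behead i_lt nth_behead => -[<- <-].
  by exists i => //; rewrite /= in i_lt *; lia.
exists (nth x0 s i, nth x0 s i.+1) => //=.
have i_zip : i < size (zip s (behead s)) by rewrite size_zip size_behead; lia.
by have := mem_nth (x0, x0) i_zip; rewrite nth_zip_cond i_zip nth_behead.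
Qed.

Lemma path_subgraph_rev s : path_subgraph (rev s) = path_subgraph s.
Proof.
have sub (r : seq G) : path_edges (rev r) \subset path_edges r.
  case: r => // x0 r; apply/subsetP=> e /(path_edgesP x0)[i].
  set s' := x0 :: r; rewrite size_rev => i_s ->; apply/(path_edgesP x0).
  exists (size s' - i.+2); first by lia.
  rewrite (nth_rev x0 (ltnW i_s)) (nth_rev x0 i_s) setUC.
  by have -> : (size s' - i.+2).+1 = size s' - i.+1 by rewrite -subSn ?subSS.
congr pair; first by apply/setP=> x; rewrite !inE mem_rev.
by apply/eqP; rewrite eqEsubset sub -{1}(revK s) sub.
Qed.

(** The condition put on the two ends of a segment. *)
Definition is_end x : bool := is_leaf x || is_branch x.

Lemma is_endE x y : adj x y -> is_end x = (degree x != 2).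
Proof.
move=> xy; have : 0 < degree x by apply/card_gt0P; exists y; rewrite inE.
rewrite /is_end /is_leaf /is_branch; lia.
Qed.

(** Separates the two ends from the internal vertices, a form in which reversal
exchanges the ends. *)
Lemma segment_seqP s :
  reflect (exists x p y, [/\ s = x :: rcons p y,
    path adj x (rcons p y) /\ uniq (x :: rcons p y),
    all (fun z => degree z == 2) p, is_end x & is_end y])
  (segment_seq s).
Proof.
apply: (iffP idP) => [|[x [p [y [-> [xp up] deg2 xe ye]]]]]; last first.
  rewrite /segment_seq xp up belast_rcons /= deg2 last_rcons.
  by rewrite -/(is_end x) -/(is_end y) xe ye -size_eq0 size_rcons.
case: s => // x p0; case/lastP: p0 => // p y.
rewrite /segment_seq belast_rcons last_rcons => /and5P[_ xp up deg2 /andP[xe ye]].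
by exists x, p, y.
Qed.

Lemma segmentsP H :
  reflect (exists2 s, segment_seq s & H = path_subgraph s) (H \in segments G).
Proof.
rewrite inE; apply: (iffP existsP) => [[l /existsP[s /andP[? /eqP]]]|[s seg ->]].
  by exists s.
have s_le : size s < #|G|.+1.
  have /segment_seqP[x [p [y [-> [_ up] _ _ _]]]] := seg.
  by rewrite ltnS -(card_uniqP up) max_card.
exists (Ordinal s_le); apply/existsP; exists (in_tuple s).
by rewrite seg eqxx.
Qed.

(** A simple path that arrives at a vertex of degree 2 has a single way to go on,
so two of them can only differ in where they stop.  The vertex [z] is the one
from which both paths arrive. *)
Lemma degree2_prefix z x p q : adj z x -> z \notin p -> z \notin q ->
  path adj x p -> uniq (x :: p) -> path adj x q -> uniq (x :: q) ->
  all (fun w => degree w == 2) (belast x p) -> prefix p q || prefix q p.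
Proof.
elim: p z x q => [|a p IHp] z x q; first by rewrite prefix0s.
case: q => [|b q]; first by rewrite prefix0s orbT.
rewrite [belast _ _]/= [path _ _ _]/= [path _ _ (b :: q)]/= !cons_uniq !in_cons !negb_or.
move=> zx /andP[za zp] /andP[zb zq] /andP[xa ap] /andP[/andP[_ x_p] up].
move=> /andP[xb bq] /andP[/andP[_ x_q] uq] /andP[deg2 all2].
have ab : a = b.
  apply/eqP/negPn/negP => ab.
  have : [set z; a; b] \subset [set w | adj x w].
    by apply/subsetP=> w; rewrite !inE -orbA => /or3P[]/eqP->; rewrite // adjC.
  move/subset_leq_card; rewrite -/(degree x) (eqP deg2) -setUA cardsU1 cards2 ab.
  by rewrite !inE negb_or za zb.
by rewrite -ab /= eqxx in bq uq *; apply: (IHp x a).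
Qed.

Lemma leaf_prefix x p q : is_leaf x ->
  path adj x p -> uniq (x :: p) -> path adj x q -> uniq (x :: q) ->
  all (fun w => degree w == 2) (behead (belast x p)) -> prefix p q || prefix q p.
Proof.
case: p q => [|a p] [|b q] // leaf_x; rewrite ?prefix0s ?orbT //.
rewrite [path _ _ _]/= [path _ _ (b :: q)]/= [belast _ _]/= [behead _]/=.
rewrite !(cons_uniq x) !in_cons !negb_or.
move=> /andP[xa ap] /andP[/andP[_ x_p] up] /andP[xb bq] /andP[/andP[_ x_q] uq] all2.
have ab : a = b.
  move/eqP: leaf_x => /eqP/cards1P[w /setP wE].
  by have := wE a; have := wE b; rewrite !inE xa xb => /esym/eqP-> /esym/eqP->.
by rewrite -ab /= eqxx in bq uq *; apply: (degree2_prefix xa).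
Qed.

Lemma leaf_segment_start H x : H \in segments G -> is_leaf x -> x \in H.1 ->
  exists p y, [/\ H = path_subgraph (x :: rcons p y),
    path adj x (rcons p y), uniq (x :: rcons p y),
    all (fun z => degree z == 2) p & is_end y].
Proof.
case/segmentsP=> s /segment_seqP[a [p [b [-> [ap up] deg2 ae be]]]] -> leaf_x.
rewrite inE in_cons mem_rcons in_cons => /or3P[/eqP->|/eqP->|xp]; first by exists p, b.
  exists (rev p), a.
  have E : b :: rcons (rev p) a = rev (a :: rcons p b) by rewrite rev_cons rev_rcons.
  split.
  - by rewrite E path_subgraph_rev.
  - have := rev_path adj a (rcons p b).
    rewrite last_rcons belast_rcons rev_cons => ->.
    by rewrite (eq_path (e' := adj)) // => ? ?; rewrite adjC.
  - by rewrite E rev_uniq.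
  - by rewrite all_rev.
  - exact: ae.
by move/(allP deg2): xp => /eqP d2; rewrite /is_leaf d2 in leaf_x.
Qed.

(** The two segments follow each other from the leaf, and neither can stop before
the other because the internal vertices have degree 2. *)
Lemma leaf_segment_unique H H' x : H \in segments G -> H' \in segments G ->
  is_leaf x -> x \in H.1 -> x \in H'.1 -> H = H'.
Proof.
move=> Hs H's leaf_x xH xH'.
have [p [y [-> xp up p2 ye]]] := leaf_segment_start Hs leaf_x xH.
have [p' [y' [-> xp' up' p2' ye']]] := leaf_segment_start H's leaf_x xH'.
have stop q r a b : path adj x (rcons q a) -> is_end a ->
    all (fun z => degree z == 2) r -> prefix (rcons q a) (rcons r b) ->
    rcons q a = rcons r b.
  move=> xq ae r2 /prefixP[w]; case/lastP: w => [|w c]; first by rewrite cats0.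
  rewrite -rcons_cat => /rcons_inj[E _].
  move: ae; rewrite (@is_endE a (last x q)).
    have: a \in r by rewrite E mem_cat mem_rcons inE eqxx.
    by move/(allP r2) ->.
  by move: xq; rewrite rcons_path adjC => /andP[].
have := leaf_prefix leaf_x xp up xp' up'; rewrite belast_rcons /= p2 => /(_ isT).
by case/orP=> /stop->.
Qed.

Section Tree.
Hypothesis G_tree : is_tree G.

(** Start a path at the leaf, prolong it to another leaf, and cut it at the first
vertex whose degree is not 2. *)
Lemma leaf_segment_exists x : is_leaf x -> exists2 H, H \in segments G & x \in H.1.
Proof.
move=> leaf_x; have /card_gt0P[y] : 0 < degree x by rewrite (eqP leaf_x).
rewrite inE => xy.
have [|/=|q [xq uq lf]] := @path_to_leaf _ G_tree x [::] y; rewrite /= ?xy ?andbT //.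
  by rewrite inE adj_neq.
move: xq uq; rewrite [_ ++ _]/= -/(rcons [::] y) => xq uq.
have has_end : has (fun z => degree z != 2) (y :: q).
  by apply/hasP; exists (last y q); rewrite ?mem_last // (eqP lf).
move: xq uq; case/split_find: has_end => z p r z2 p2.
rewrite -cat_cons cat_uniq cat_path => /andP[xp _] /and3P[up _ _].
exists (path_subgraph (x :: rcons p z)); last by rewrite !inE eqxx.
apply/segmentsP; exists (x :: rcons p z) => //; apply/segment_seqP.
exists x, p, z; split=> //.
- by move: p2; rewrite -all_predC; apply: sub_all => w /= /negPn.
- by rewrite /is_end leaf_x.
- by rewrite (@is_endE z (last x p)) //; move: xp; rewrite rcons_path adjC => /andP[].
Qed.

(** A simple path from [x] to any vertex runs along this path, and cannot leave
it at its far end, which is a leaf. *)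
Lemma leaf_to_leaf_spans x p y : is_leaf x -> is_leaf y ->
  path adj x (rcons p y) -> uniq (x :: rcons p y) ->
  all (fun z => degree z == 2) p -> forall w, w \in x :: rcons p y.
Proof.
move=> leaf_x leaf_y xp up p2 w.
have [q [xq uq <-]] := path_connected x w G_tree.1.
have := leaf_prefix leaf_x xp up xq uq; rewrite belast_rcons p2 => /(_ isT).
case/orP=> /prefixP[r E]; last by rewrite E -cat_cons mem_cat mem_last.
(* If the path went on beyond [y], to [a], then [y] would have two neighbours. *)
case: r E => [|a r] E; first by rewrite E cats0 mem_last.
move: xq uq; rewrite E -cat_cons cat_uniq cat_path /= last_rcons.
case/and3P=> _ ya _ /and3P[_ /norP[a_p _] _].
have yx : adj y (last x p) by move: xp; rewrite rcons_path adjC => /andP[].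
move/cards1P: leaf_y => [b /setP bE].
have := bE a; have := bE (last x p); rewrite !inE ya yx => /esym/eqP lE /esym/eqP aE.
by move: a_p; rewrite aE -lE -rcons_cons mem_rcons inE mem_last orbT.
Qed.

(** If every segment contains at most one leaf, charge each leaf to its segment.
Otherwise the tree is a path, and the bound 2 is needed. *)
Lemma card_leaves_leq : #|leaves G| <= maxn 2 #|segments G|.
Proof.
have [/existsP[H /andP[Hs two]]|] :=
  boolP [exists H in segments G, 1 < #|[set x in leaves G | x \in H.1]|].
  case/card_gt1P: two => x [y []]; rewrite !inE => /andP[lx xH] /andP[ly yH] xy.
  have [p [z [HE xp up p2 ze]]] := leaf_segment_start Hs lx xH.
  have yz : y = z.
    move: yH; rewrite HE inE in_cons mem_rcons in_cons eq_sym (negbTE xy) /=.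
    case/orP=> [/eqP //|/(allP p2)/eqP y2]; by rewrite /is_leaf y2 in ly.
  rewrite -{}yz in xp up.
  rewrite leq_max; apply/orP; left.
  apply: leq_trans (_ : #|[set x; y]| <= 2); last by rewrite cards2; case: (x != y).
  apply/subset_leq_card/subsetP=> w; rewrite !inE => lw.
  have := leaf_to_leaf_spans lx ly xp up p2 w; rewrite in_cons mem_rcons in_cons.
  case/or3P=> [->|->|/(allP p2)/eqP w2] //; rewrite ?orbT //.
  by rewrite /is_leaf w2 in lw.
rewrite negb_exists => /forallP few; rewrite leq_max; apply/orP; right.
rewrite -[#|segments G|]muln1.
apply: (leq_card_rel (R := fun x (H : subgraph G) => x \in H.1)) => [x|H Hs].
  by rewrite inE => /leaf_segment_exists.
by have := few H; rewrite Hs /= -leqNgt.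
Qed.

End Tree.
End Segments.

(** * Starlike trees *)

(** The term of [i] bounds the number of edges of a leg of length [i] whose two
sides have more than [t] vertices.  For at most two legs the second
truncation, coming from the side of the centre, matters; for balanced legs
the first one suffices, as the differences [i - t] are then all exact or all 0. *)
Lemma sum_truncated_legs (r : seq nat) (t : nat) :
  (2 < size r -> {in r &, forall i j, i <= j.+1}) ->
  \sum_(i <- r) ((i - t) - (t - (\sum_(j <- r) j - i)))
  <= \sum_(j <- r) j - t * maxn 2 (size r).
Proof.
case: r => [|i [|j [|k r]]] balanced.
- by rewrite !big_nil.
- by rewrite !big_cons !big_nil /=; lia.
- by rewrite !big_cons !big_nil /=; lia.
have {balanced} := balanced isT; rewrite (maxn_idPr _) //.
set s := [:: i, j, k & r] => balanced.
apply: leq_trans (_ : \sum_(l <- s) (l - t) <= _).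
  by apply: leq_sum => l _; lia.
have tE : t * size s = \sum_(l <- s) t.
  by rewrite big_const_seq count_predT iter_addn_0.
have [/allP long|/allPn[l ls short]] := boolP (all (leq t) s).
  rewrite leq_subRL tE; last by rewrite [leqLHS]big_seq [leqRHS]big_seq; apply: leq_sum.
  rewrite -big_split /= [leqLHS]big_seq [leqRHS]big_seq.
  by apply: leq_sum => l /long; lia.
rewrite big_seq big1 // => l' l's; have := balanced l' l l's ls; lia.
Qed.

Section Starlike.
Variables (G : sgraph) (c : G) (ps : seq (seq G)).
Hypotheses (G_tree : is_tree G) (ps_nnil : [::] \notin ps)
  (ps_enum : perm_eq (c :: flatten ps) (enum G))
  (ps_edges : edges G = \bigcup_(p <- ps) path_edges (c :: p)).
Implicit Types (x y a b : G) (p q : seq G).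

Let cps_uniq : uniq (c :: flatten ps).
Proof. by rewrite (perm_uniq ps_enum) enum_uniq. Qed.

Lemma leg_uniq p : p \in ps -> uniq (c :: p).
Proof.
move=> pP; case/andP: cps_uniq => c_ps u.
rewrite cons_uniq (uniq_flatten_mem u pP) andbT; apply: contra c_ps => cp.
by apply/flattenP; exists p.
Qed.

Lemma leg_mem_eq p q x : p \in ps -> q \in ps -> x \in p -> x \in q -> p = q.
Proof. by case/andP: cps_uniq => _ u; apply: flatten_disjoint. Qed.

Lemma leg_cover x : x != c -> exists2 p, p \in ps & x \in p.
Proof.
move=> xc; have : x \in c :: flatten ps by rewrite (perm_mem ps_enum) mem_enum.
by rewrite in_cons (negbTE xc) /= => /flattenP.
Qed.

Lemma sum_legs : \sum_(p <- ps) size p = #|G|.-1.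
Proof.
by rewrite cardE -(perm_size ps_enum) /= size_flatten sumnE big_map.
Qed.

Lemma leg_edgesP e : reflect
  (exists p i, [/\ p \in ps, i < size p & e = [set nth c (c :: p) i; nth c p i]])
  (e \in edges G).
Proof.
rewrite ps_edges; apply: (iffP (mem_bigcup_seq _ _ _)) => [[p pP]|[p [i [pP ip ->]]]].
  by case/(path_edgesP c) => i /= ip ->; exists p, i.
by exists p => //; apply/(path_edgesP c); exists i.
Qed.

Lemma leg_adj p i : p \in ps -> i < size p -> adj (nth c (c :: p) i) (nth c p i).
Proof. by move=> pP ip; rewrite -mem_edges; apply/leg_edgesP; exists p, i. Qed.

Lemma leg_nth_inj p q i j : p \in ps -> q \in ps -> i < size p -> j < size q ->
  nth c p i = nth c q j -> p = q /\ i = j.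
Proof.
move=> pP qP ip jq E; have pq : p = q.
  by apply: (leg_mem_eq pP qP (mem_nth c ip)); rewrite E mem_nth.
split=> //; subst q; apply/eqP.
by rewrite -(nth_uniq c ip jq) ?E //; case/andP: (leg_uniq pP).
Qed.

Lemma leg_adjE p i y : p \in ps -> i < size p ->
  adj (nth c p i) y = (y == nth c (c :: p) i) || (i.+1 < size p) && (y == nth c p i.+1).
Proof.
move=> pP ip; apply/idP/idP; last first.
  case/orP=> [/eqP->|/andP[ip1 /eqP->]]; first by rewrite adjC leg_adj.
  exact: (@leg_adj p i.+1).
rewrite -mem_edges => /leg_edgesP[q [j [qP jq /set2_eq]]].
case=> [][]; last first.
  by move=> /(leg_nth_inj pP qP ip jq)[<- <-] ->; rewrite eqxx.
case: j jq => [|j] jq /=.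
  by move=> E; have /andP[] := leg_uniq pP; rewrite -E mem_nth.
move=> /(leg_nth_inj pP qP ip (ltnW jq))[? ?] ->; subst q j.
by rewrite jq eqxx orbT.
Qed.

Lemma degree_leg p i : p \in ps -> i < size p ->
  degree (nth c p i) = (i.+1 < size p).+1.
Proof.
move=> pP ip; rewrite /degree.
have -> : [set y | adj (nth c p i) y] = nth c (c :: p) i |:
    (if i.+1 < size p then [set nth c p i.+1] else set0).
  by apply/setP=> y; rewrite !inE leg_adjE //; case: ifP; rewrite ?inE.
case: ifP => ip1; last by rewrite setU0 cards1.
rewrite cards2 -[nth c p i.+1]/(nth c (c :: p) i.+2) nth_uniq ?leg_uniq //=; lia.
Qed.

Lemma degree_center : size ps <= degree c.
Proof.
have ps_uniq : uniq ps by case/andP: cps_uniq => _; apply: uniq_flatten_nnil.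
have nnil p : p \in ps -> 0 < size p.
  by move=> pP; rewrite lt0n size_eq0; apply: contraNneq ps_nnil => <-.
rewrite -(size_map (fun p => nth c p 0)) /degree cardE.
apply: uniq_leq_size => [|_ /mapP[p pP ->]].
  rewrite map_inj_in_uniq // => p q pP qP.
  by case/(leg_nth_inj pP qP (nnil p pP) (nnil q qP)).
by rewrite mem_enum inE; apply: (leg_adj pP (nnil p pP)).
Qed.

Lemma leg_split p : p \in ps -> exists q, p = rcons q (last c p).
Proof.
case/lastP: p => [|q y] pP; first by rewrite (negbTE ps_nnil) in pP.
by exists q; rewrite last_rcons.
Qed.

Lemma leaf_leg_tip p : p \in ps -> is_leaf (last c p).
Proof.
move=> pP; have [q pE] := leg_split pP.
have p_gt0 : 0 < size p by rewrite pE size_rcons.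
by rewrite /is_leaf -nth_last degree_leg ?prednK ?ltnn.
Qed.

Lemma leaf_is_leg_tip x : x != c -> is_end x -> exists2 p, p \in ps & x = last c p.
Proof.
move=> /leg_cover[p pP /(nthP c)[i ip <-]].
rewrite /is_end /is_leaf /is_branch degree_leg //; case: ltnP => // pi _.
exists p => //; rewrite -nth_last.
by have -> : size p = i.+1 by apply/anti_leq; rewrite pi ip.
Qed.

(** Vertices other than the centre have degree at most 2, so each segment ends at
the tip of a leg; and the tip, being a leaf, lies on one segment only. *)
Lemma card_segments_starlike : #|segments G| <= size ps.
Proof.
have tips_le : #|[set x in [seq last c p | p <- ps]]| <= size ps.
  by rewrite cardsE; apply: leq_trans (card_size _) _; rewrite size_map.
apply: leq_trans tips_le; rewrite -[X in _ <= X]muln1.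
apply: (leq_card_rel (R := fun (H : subgraph G) x => x \in H.1)) => [H|x].
  case/segmentsP=> s /segment_seqP[x [p [y [-> [_ up] _ xe ye]]]] ->.
  have tip z : z != c -> is_end z -> z \in [set x in [seq last c p | p <- ps]].
    by move=> zc /(leaf_is_leg_tip zc)[q qP ->]; rewrite inE map_f.
  have [xc|xc] := eqVneq x c; last first.
    by exists x; [apply: tip | rewrite inE mem_head].
  exists y; last by rewrite inE in_cons mem_rcons mem_head orbT.
  apply: tip => //; move: up; rewrite -rcons_cons rcons_uniq xc.
  by case/andP=> + _; apply: contraNneq => ->; rewrite mem_head.
rewrite inE => /mapP[p pP ->]; apply/card_le1_eqP => H H'.
case/setIdP=> Hs xH /setIdP[H's xH'].
exact: leaf_segment_unique H's Hs (leaf_leg_tip pP) xH' xH.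
Qed.

(** With three legs the centre is a branch vertex, so that segments stop there. *)
Lemma leg_segment p : 2 < size ps -> p \in ps -> path_subgraph (c :: p) \in segments G.
Proof.
move=> big pP; apply/segmentsP; exists (c :: p) => //; apply/segment_seqP.
have [q pE] := leg_split pP; exists c, q, (last c p); rewrite -pE; split=> //.
- split; last exact: leg_uniq.
  by apply/(pathP c) => i; apply: leg_adj.
- apply/(all_nthP c) => i iq; have ip : i.+1 < size p by rewrite pE size_rcons.
  have -> : nth c q i = nth c p i by rewrite pE nth_rcons iq.
  by rewrite degree_leg ?ip // ltnW.
- by rewrite /is_end /is_branch (leq_trans big degree_center) orbT.
- by rewrite /is_end leaf_leg_tip.
Qed.

Definition leg_edge p (i : nat) : {set G} := [set nth c (c :: p) i; nth c p i].

Lemma leg_edge_inj p i j : p \in ps -> i < size p -> j < size p ->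
  leg_edge p i = leg_edge p j -> i = j.
Proof.
move=> pP ip jp /set2_eq[][/eqP E1 /eqP E2].
  by move: E2; rewrite nth_uniq // => [/eqP//|]; case/andP: (leg_uniq pP).
(* The crossed identification would make [i] and [j] successors of each other. *)
move: E1 E2; rewrite -![nth c p _]/(nth c (c :: p) _.+1).
rewrite !nth_uniq ?leg_uniq //=; lia.
Qed.

Lemma leg_length p : p \in ps -> #|path_edges (c :: p)| = size p.
Proof.
move=> pP; rewrite -[RHS]card_ord -cardsT.
have inj : injective (fun i : 'I_(size p) => leg_edge p i).
  by move=> i j /(leg_edge_inj pP (ltn_ord i) (ltn_ord j))/val_inj.
rewrite -(card_imset _ inj); apply: eq_card => e.
apply/(path_edgesP c)/imsetP => [[i /= ip ->]|[i _ ->]].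
  by exists (Ordinal (ip : i < size p)).
by exists i => //; rewrite /= ltnS.
Qed.

(** The vertices of [p] from position [i] on are cut off from the others by the
deletion of the [i]-th edge. *)
Lemma minside_leg_edge p i : p \in ps -> i < size p ->
  minside (leg_edge p i) <= minn (size p - i) (#|G| - (size p - i)).
Proof.
move=> pP ip; set e := leg_edge p i; set D : {set G} := [set x in drop i p].
have up : uniq p by case/andP: (leg_uniq pP).
have D_card : #|D| = size p - i.
  by rewrite cardsE (card_uniqP _) ?drop_uniq // size_drop.
have nthD j : j < size p -> (nth c p j \in D) = (i <= j).
  move=> jp; rewrite inE; case: leqP => ij.
    rewrite -(subnKC ij) -nth_drop mem_nth // size_drop.
    exact: ltn_sub2r (leq_ltn_trans ij jp) jp.
  apply/negP=> /(nthP c)[k]; rewrite size_drop nth_drop ltn_subRL => kp /eqP.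
  by rewrite nth_uniq //; lia.
have cD : c \notin D.
  by rewrite inE; apply/negP=> /mem_drop; apply/negP; case/andP: (leg_uniq pP).
have nthcD j : j <= size p -> (nth c (c :: p) j \in D) = (i < j).
  by case: j => [|j] jp; [rewrite (negbTE cD) | rewrite nthD].
(* Only the [i]-th edge of [p] has exactly one end in [D]. *)
have D_closed : closed (cut_adj e) D.
  have step q j : q \in ps -> j < size q -> leg_edge q j != e ->
      (nth c (c :: q) j \in D) = (nth c q j \in D).
    move=> qP jq ne; have [pq|pq] := eqVneq q p.
      subst q; rewrite nthcD ?(ltnW jq) // nthD // ltn_neqAle.
      by rewrite (_ : i != j) //; apply: contraNneq ne => ij; rewrite /e ij.
    have off x : x \in q -> x \notin D.
      move=> xq; rewrite inE; apply: contra pq => /mem_drop xp.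
      by apply/eqP/(leg_mem_eq qP pP xq xp).
    rewrite (negbTE (off _ (mem_nth c jq))); apply/negbTE.
    by case: j jq {ne} => //= j jq; rewrite off ?mem_nth // ltnW.
  move=> a b /andP[ab ne]; move: (ab); rewrite -mem_edges.
  case/leg_edgesP=> q [j [qP jq E]]; have := step q j qP jq.
  rewrite /leg_edge -E => /(_ ne); by case/set2_eq: E => [][-> ->].
have side_sub x : x \in D -> side e x \subset D.
  move=> xD; apply/subsetP=> y; rewrite inE => xy.
  by rewrite -(closed_connect D_closed xy).
have side_subC x : x \notin D -> side e x \subset ~: D.
  move=> xD; apply/subsetP=> y; rewrite !in_set => xy.
  have := closed_connect D_closed xy; rewrite !in_set => <-.
  by rewrite in_set in xD.
have vD : nth c p i \in D by rewrite nthD.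
have uD : nth c (c :: p) i \notin D by rewrite nthcD ?ltnn // ltnW.
rewrite minsideE ?leg_adj //.
have := subset_leq_card (side_sub _ vD); have := subset_leq_card (side_subC _ uD).
rewrite (cardsCs (~: D)) setCK D_card => u_le v_le.
by rewrite leq_min !geq_min v_le u_le orbT.
Qed.

Lemma card_heavy_leg_edges p t : p \in ps ->
  #|[set e in path_edges (c :: p) | t < minside e]|
  <= (size p - t) - (t - (#|G|.-1 - size p)).
Proof.
move=> pP; pose I := [set i : 'I_(size p) | t < minside (leg_edge p i)].
have sub : [set e in path_edges (c :: p) | t < minside e]
    \subset [set leg_edge p (i : 'I_(size p)) | i in I].
  apply/subsetP=> e; rewrite inE => /andP[/(path_edgesP c)[i /= ip ->] ti].
  by apply/imsetP; exists (Ordinal (ip : i < size p)); rewrite ?inE.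
apply: leq_trans (subset_leq_card sub) _; apply: leq_trans (leq_imset_card _ _) _.
apply: card_inj_itv (@nat_of_ord _) _ _ _ _ => [i j _ _|i]; first exact: val_inj.
rewrite inE => ti; have := minside_leg_edge pP (ltn_ord i); have := ltn_ord i.
lia.
Qed.

Lemma card_heavy_edges_starlike t :
  (2 < size ps -> {in ps &, forall p q, size p <= (size q).+1}) ->
  #|[set e in edges G | t < minside e]| <= #|G|.-1 - t * maxn 2 (size ps).
Proof.
move=> balanced; rewrite ps_edges.
apply: leq_trans (leq_card_bigcup_seq (fun p => @card_heavy_leg_edges p t)) _.
rewrite -sum_legs -(size_map size ps).
rewrite -(big_map size predT (fun i => i)).
rewrite -(big_map size predT (fun i => (i - t) - (t - (\sum_(j <- map size ps) j - i)))).
apply: sum_truncated_legs; rewrite size_map => /balanced bal.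
by move=> _ _ /mapP[p pP ->] /mapP[q qP ->]; apply: bal.
Qed.

End Starlike.

(** * Comparison of the two trees *)

Theorem theorem5p1 (n m k : nat) (k_gt0 : 0 < k) (Tstar T : sgraph)
    (Tstar_bal : balanced_starlike_tree Tstar)
    (Tstar_n : #|Tstar| = n) (Tstar_m : #|segments Tstar| = m)
    (T_tree : is_tree T) (T_n : #|T| = n) (T_m : #|segments T| = m) :
  steiner_wiener Tstar k <= steiner_wiener T k.
Proof.
case: Tstar_bal => star_tree [c [ps [ps_nnil ps_enum ps_edges]]] balanced.
have leaves_le : #|leaves T| <= maxn 2 (size ps).
  apply: leq_trans (card_leaves_leq T_tree) _.
  have := card_segments_starlike ps_nnil ps_enum ps_edges; lia.
rewrite !steiner_wienerE // Tstar_n T_n; apply: leq_sum => t _.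
rewrite leq_mul2r; apply/orP; right.
apply: leq_trans (card_heavy_edges_geq T_tree t); rewrite T_n.
apply: leq_trans (card_heavy_edges_starlike star_tree ps_nnil ps_enum ps_edges t _) _.
  move=> big p q pP qP.
  have := balanced _ _ (leg_segment ps_nnil ps_enum ps_edges big pP)
                       (leg_segment ps_nnil ps_enum ps_edges big qP).
  by rewrite /segment_length /= !(leg_length ps_nnil ps_enum).
by rewrite Tstar_n leq_sub2l // leq_mul2l leaves_le orbT.
Qed.
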